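(* Under the model and conditions of the context, let $\Sigma_{U_0}>0$ be given and suppose the alternative hypothesis $\Sigma_U\neq\Sigma_{U_0}$ holds. Take $f(x)=x^2$. If $$p^{-1}\mathrm{tr}\big\{(\Sigma_{U_0}^{-1/2}\Sigma_U\Sigma_{U_0}^{-1/2}-I)^2\big\}\ge c$$ for some constant $c>0$, then $P(|\mathcal{T}|>c_\alpha)\to1$ for any $\alpha\in(0,1)$, where $c_\alpha$ is the $\alpha$-th quantile of the standard normal distribution.
   Context: Model: $Y_t=UX_tV'$, $t=1,\dots,T$, with $U$ ($p\times p$), $V$ ($q\times q$) deterministic, $\Sigma_U=UU'$, $\Sigma_V=VV'$, and $X_t$ random $p\times q$ matrices. Conditions, as $\min\{p,T,q\}\to\infty$: all entries of $X_1,\dots,X_T$ are i.i.d. real with mean $0$, variance $1$, fourth moment $\nu_4$ and finite $(4+\delta_0)$-th absolute moment for some $\delta_0>0$; $p/(Tq)\to0$; $\Sigma_U$ and $I_T\otimes\Sigma_V$ have bounded eigenvalues and their empirical spectral distributions converge to probability distributions not degenerate at $0$; $q^{-1}\mathrm{tr}(\Sigma_V)=1$. Statistic: $\tilde Y_t=\Sigma_{U_0}^{-1/2}Y_t$, $\tilde S=\{(Tq)/p\}^{1/2}\{(Tq)^{-1}\sum_{t=1}^T\tilde Y_t\tilde Y_t'-I_p\}$ with eigenvalues $\lambda_j^{\tilde S}$, and $\mathcal{T}=\{\sum_{j=1}^pf(\lambda_j^{\tilde S})-\mu\}/\sigma$. For $f(x)=x^2$, $$\mu=(p+1)\bar\lambda_{\Sigma_V^2}+q^{-1}(\nu_4-3)\sum_{j=1}^q\sigma_j^4,\qquad\sigma^2=4\bar\lambda_{\Sigma_V^2}^2,$$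 where $\bar\lambda_{\Sigma_V^2}=q^{-1}\mathrm{tr}(\Sigma_V^2)$ and $\mathrm{diag}(\Sigma_V)=(\sigma_1^2,\dots,\sigma_q^2)$. *)

(* Defs.v *)
From mathcomp Require Import all_boot all_order all_algebra.
From mathcomp Require Import polyrcf mxtens.
From mathcomp Require Import all_classical all_reals all_analysis.

Set Implicit Arguments.
Unset Strict Implicit.
Unset Printing Implicit Defensive.

Import Order.TTheory GRing.Theory Num.Theory.
Import numFieldNormedType.Exports.

Local Open Scope classical_set_scope.
Local Open Scope ring_scope.

Section Matrices.
Context {R : realType}.

(* Real eigenvalues in increasing order, repeated according to algebraic
   multiplicity; for a symmetric A of size n this list has length n. *)
Definition eigvals n (A : 'M[R]_n) : seq R :=
  flatten [seq nseq (mup x (char_poly A)) x | x <- rootsR (char_poly A)].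

Definition lin_eig_stat (f : R -> R) n (A : 'M[R]_n) : R :=
  \sum_(x <- eigvals A) f x.

(* Cumulative distribution function of the empirical spectral distribution. *)
Definition esd n (A : 'M[R]_n) (x : R) : R :=
  (count (fun l => l <= x) (eigvals A))%:R / n%:R.

Definition bounded_eigenvalues (k : nat -> nat)
    (A : forall n, 'M[R]_(k n)) : Prop :=
  exists C : R, forall n (a : R), eigenvalue (A n) a -> `|a| <= C.

(* Weak convergence of the empirical spectral distributions to H, i.e.
   convergence of the distribution functions at the continuity points of
   that of H. *)
Definition esd_cvg (k : nat -> nat) (A : forall n, 'M[R]_(k n))
    (H : probability (measurableTypeR R) R) : Prop :=
  forall x : R, {for x, continuous (fun y : R => fine (H `]-oo, y]%classic))} ->
    esd (A n) x @[n --> \oo] --> fine (H `]-oo, x]%classic).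

Definition esd_cvg_nondegenerate (k : nat -> nat)
    (A : forall n, 'M[R]_(k n)) : Prop :=
  exists H : probability (measurableTypeR R) R,
    esd_cvg A H /\ H [set 0] != 1%E.

Definition posdefmx n (A : 'M[R]_n) : Prop :=
  A^T = A /\ forall v : 'cV[R]_n, v != 0 -> 0 < (v^T *m A *m v) 0 0.

(* For positive definite A there is exactly one matrix as described here; the
   default value 0 only serves the other matrices. *)
Definition sqrtmx n (A : 'M[R]_n) : 'M[R]_n :=
  xget 0 [set B : 'M[R]_n | posdefmx B /\ B *m B = A].

Definition invsqrtmx n (A : 'M[R]_n) : 'M[R]_n := invmx (sqrtmx A).

Definition avg_trace n (A : 'M[R]_n) : R := n%:R^-1 * \tr A.

End Matrices.

Section Probability.
Context {R : realType}.

(* Independence of a finite family of real random variables. Events of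
   subfamilies are covered by taking B i to be the whole line. *)
Definition independent_RVs d (Omega : measurableType d)
    (P : probability Omega R) (I : finType) (X : I -> {RV P >-> R}) : Prop :=
  forall B : I -> set R, (forall i, measurable (B i)) ->
    P [set w | forall i, B i (X i w)] =
      (\prod_(i : I) P (X i @^-1` B i))%E.

Definition normal_quantile (alpha : R) : R :=
  inf [set x : R | (alpha%:E <= normal_prob 0 1 `]-oo, x]%classic)%E].

End Probability.

Section Statistic.
Context {R : realType} (p T q : nat).

Definition samp_Y (U : 'M[R]_p) (V : 'M[R]_q)
    (X : 'I_T -> 'M[R]_(p, q)) (t : 'I_T) : 'M[R]_(p, q) :=
  U *m X t *m V^T.

Definition S_tilde (Sigma0 : 'M[R]_p) (Y : 'I_T -> 'M[R]_(p, q)) : 'M[R]_p :=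
  let Yt t := invsqrtmx Sigma0 *m Y t in
  Num.sqrt ((T * q)%:R / p%:R) *:
    ((T * q)%:R^-1 *: (\sum_(t < T) Yt t *m (Yt t)^T) - 1%:M).

Definition test_stat (f : R -> R) (mu sigma : R) (Sigma0 : 'M[R]_p)
    (Y : 'I_T -> 'M[R]_(p, q)) : R :=
  (lin_eig_stat f (S_tilde Sigma0 Y) - mu) / sigma.

Definition mu_sq (nu4 : R) (SigmaV : 'M[R]_q) : R :=
  p.+1%:R * avg_trace (SigmaV *m SigmaV)
  + q%:R^-1 * (nu4 - 3) * \sum_(j < q) (SigmaV j j) ^+ 2.

Definition sigma2_sq (SigmaV : 'M[R]_q) : R :=
  4 * (avg_trace (SigmaV *m SigmaV)) ^+ 2.

End Statistic.

(* Main.v *)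
Require Import Defs.
From HB Require Import structures.
From mathcomp Require Import all_boot all_order all_algebra.
From mathcomp Require Import polyrcf mxtens.
From mathcomp Require Import all_classical all_reals all_analysis.
From mathcomp Require Import measurable_realfun sesquilinear spectral complex.
From mathcomp Require Import ring lra.

(* Write N = Tq, A = Sigma0^{-1/2} U, M = A A', and let W be the normalised
   sample covariance matrix of the transformed data, so that E W = M and
   tr (S~^2) = (N / p) ||W - I||_F^2. Each entry of W - M is a centred quadratic
   form in the entries of the X_t; bounding its variance by the squared
   Frobenius norm of its coefficients gives
     E ||W - M||_F^2 <= K (tr M)^2 / N,
   where K depends only on nu4 and on the bound for Sigma_V. With
   D = ||M - I||_F^2 >= c p one has (tr M)^2 <= 2 (1 + 1/c) p D, so by Markov's
   inequality ||W - M||_F^2 < D / 4, and hence ||W - I||_F^2 >= D / 4 >= c p / 4,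
   outside an event of probability O(p / N). There tr (S~^2) >= c N / 4, which
   dominates mu = O(p), while sigma is bounded. *)

Set Implicit Arguments.
Unset Strict Implicit.
Unset Printing Implicit Defensive.

Import Order.TTheory GRing.Theory Num.Theory.
Import numFieldNormedType.Exports.

Local Open Scope classical_set_scope.
Local Open Scope ring_scope.

(** * Expectations of products of independent random variables *)

Section OneFactor.
Context d d' (Om : measurableType d) (E : measurableType d') (R : realType).
Context (P : {measure set Om -> \bar R}) (F : {measure set E -> \bar R}).
Import HBNNSimple.

(** Factorisation against a fixed weight [G], assumed for indicators, passes to simple functions by
    linearity and then to nonnegative measurable [f] by monotone convergence. In the application [F]
    is the law of one variable and [G] the product of the remaining factors. *)
Lemma ge0_integral_indicM (X : Om -> E) (G : Om -> R) (c : R) (f : E -> R) :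
  measurable_fun setT X -> measurable_fun setT G -> (forall w, 0 <= G w) ->
  0 <= c ->
  (forall B, measurable B ->
     (\int[P]_w (\1_B (X w) * G w)%:E = F B * c%:E)%E) ->
  measurable_fun setT f -> (forall x, 0 <= f x) ->
  (\int[P]_w (f (X w) * G w)%:E = \int[F]_x (f x)%:E * c%:E)%E.
Proof.
move=> mX mG G0 c0 HB mf f0.
have mf' : measurable_fun setT (EFin \o f).
  exact/measurable_EFinP.
pose h := nnsfun_approx measurableT mf'.
have hf x : ((fun k => (h k x)%:E) n) @[n --> \oo] --> (f x)%:E.
  by apply: (@cvg_nnsfun_approx _ _ _ _ measurableT _ mf') => // y _ /=; rewrite lee_fin.
have hle x : {homo (fun n => h n x) : m n / (m <= n)%N >-> m <= n}.
  by move=> m n mn; exact/lefP/nd_nnsfun_approx.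
have mh n : measurable_fun setT (h n : E -> R) by exact: measurable_funP.
transitivity (limn (fun n => \int[P]_w (h n (X w) * G w)%:E))%E.
  rewrite -monotone_convergence//.
  - apply: eq_integral => w _; apply/esym/cvg_lim => //.
    rewrite EFinM.
    under eq_fun do rewrite EFinM.
    by apply: cvgeZr => //; exact: hf.
  - move=> n; apply/measurable_EFinP; apply: measurable_funM => //.
    exact: measurableT_comp.
  - by move=> n w _; rewrite lee_fin mulr_ge0.
  - by move=> w _ m n mn; rewrite lee_fin ler_wpM2r// hle.
transitivity (limn (fun n => \int[F]_x (h n x)%:E * c%:E))%E; last first.
  apply/cvg_lim => //; apply: cvgeZr => //.
  have := @cvg_monotone_convergence _ _ _ F setT measurableT (fun n x => (h n x)%:E).
  move=> /(_ _ _ _) H.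
  rewrite (_ : \int[F]_x (f x)%:E = \int[F]_x limn (fun n => (h n x)%:E))%E.
    apply: H.
    - by move=> n; apply/measurable_EFinP; exact: mh.
    - by move=> n x _; rewrite lee_fin.
    - by move=> x _ m n mn; rewrite lee_fin hle.
  by apply: eq_integral => x _; apply/esym/cvg_lim => //; exact: hf.
(* It remains to treat the simple function [h n], which is decomposed along its finitely many
   values. *)
congr (limn _); apply/funext => n.
have mhk k : measurable (h n @^-1` [set k]).
  by rewrite -[_ @^-1` _]setTI; exact: mh.
have mI k : measurable_fun setT (fun w : Om => (\1_(h n @^-1` [set k]) (X w) : R)).
  by apply: measurableT_comp => //; exact: measurable_indic.
transitivity (\sum_(k \in range (h n))
    \int[P]_w (k%:E * (\1_(h n @^-1` [set k]) (X w) * G w)%:E))%E.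
  rewrite -ge0_integral_fsum//; last 2 first.
  - move=> k; apply: emeasurable_funM => //; apply/measurable_EFinP.
    by apply: measurable_funM.
  - move=> k w _; rewrite -EFinM mulrA lee_fin mulr_ge0//.
    by have := nnfun_muleindic_ge0 (h n) k (X w); rewrite -EFinM lee_fin.
  apply: eq_integral => w _; rewrite {1}fimfunE EFinM -fsumEFin//.
  rewrite ge0_mule_fsuml; last by move=> k; exact: nnfun_muleindic_ge0.
  by apply: eq_fsbigr => k _; rewrite -!EFinM mulrA.
transitivity (\sum_(k \in range (h n)) (k%:E * F (h n @^-1` [set k]) * c%:E))%E.
  apply: eq_fsbigr => k; rewrite inE => -[x _ <-].
  rewrite ge0_integralZl//.
  - by rewrite HB// muleA.
  - by apply/measurable_EFinP; apply: measurable_funM.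
  - by move=> w _; rewrite lee_fin mulr_ge0.
  - by rewrite lee_fin.
transitivity ((\sum_(k \in range (h n)) k%:E * F (h n @^-1` [set k])) * c%:E)%E.
  rewrite ge0_mule_fsuml//.
  move=> k; have [k0|k0] := leP 0 k; first by rewrite mule_ge0.
  by rewrite preimage_nnfun0// measure0 mule0.
congr (_ * _)%E.
by rewrite integralT_nnsfun sintegralE.
Qed.
End OneFactor.

Section ProductFormula.
Context d (Om : measurableType d) (R : realType) (P : probability Om R).
Context (I : finType) (X : I -> {RV P >-> R}).
Hypothesis indX : independent_RVs X.

Lemma measurable_prod_RV (Q : pred I) (f : I -> R -> R) :
  (forall i, measurable_fun setT (f i)) ->
  measurable_fun setT (fun w => \prod_(i | Q i) f i (X i w)).
Proof.
move=> mf.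
under eq_fun do rewrite -big_filter.
by apply: measurable_prod => i _; exact: measurableT_comp.
Qed.

Lemma integral_indic_comp (i : I) (B : set R) : measurable B ->
  (\int[P]_w (\1_B (X i w))%:E)%E = P (X i @^-1` B).
Proof.
move=> mB; rewrite (_ : (fun w => _) = (fun w => (\1_(X i @^-1` B) w)%:E)).
  by rewrite integral_indic ?setIT// -[X in measurable X]setTI; exact: measurable_funP.
by apply/funext => w; rewrite !indicE; congr (_%:R%:E).
Qed.

(** The product of the indicators is the indicator of the joint event, so this is independence
    itself, rewritten with integrals. *)
Lemma integral_prod_indic (B : I -> set R) : (forall i, measurable (B i)) ->
  (\int[P]_w (\prod_i \1_(B i) (X i w))%:E =
   \prod_i \int[P]_w (\1_(B i) (X i w))%:E)%E.
Proof.
move=> mB.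
under eq_bigr do rewrite integral_indic_comp//.
rewrite -(indX mB).
set A := [set w | forall i, B i (X i w)].
have mA : measurable A.
  rewrite (_ : A = \big[setI/setT]_(i : I) (X i @^-1` (B i))); last first.
    apply/seteqP; split=> [w Aw|w].
      by rewrite -bigcap_seq => i _; exact: Aw.
    by rewrite -bigcap_seq => H i; apply: H => /=; exact: mem_index_enum.
  apply: bigsetI_measurable => i _.
  by rewrite -[X in measurable X]setTI; exact: measurable_funP.
rewrite -[X in P X]setIT -integral_indic//; apply: eq_integral => w _; congr (_%:E).
have [Aw|nAw] := pselect (A w).
  rewrite [RHS]indicE mem_set//; apply: big1 => i _.
  by rewrite indicE mem_set//; exact: Aw.
rewrite [RHS]indicE memNset//.
have [i Hi] : exists i, ~ B i (X i w).
  by apply: contrapT => H; apply: nAw => i; apply: contrapT => nB; apply: H; exists i.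
by rewrite (bigD1 i)//= indicE memNset// mul0r.
Qed.

Lemma ge0_integral_prod (f : I -> R -> R) (m : I -> R) :
  (forall i, measurable_fun setT (f i)) -> (forall i x, 0 <= f i x) ->
  (forall i, (\int[P]_w (f i (X i w))%:E = (m i)%:E)%E) ->
  (\int[P]_w (\prod_i f i (X i w))%:E = (\prod_i m i)%:E)%E.
Proof.
(* Induction on the set [J] of indices whose factor need not be an indicator. *)
suff: forall (J : seq I) (f : I -> R -> R) (m : I -> R),
  (forall i, measurable_fun setT (f i)) -> (forall i x, 0 <= f i x) ->
  (forall i, (\int[P]_w (f i (X i w))%:E = (m i)%:E)%E) ->
  (forall i, i \notin J -> exists2 B, measurable B & f i = \1_B) ->
  (\int[P]_w (\prod_i f i (X i w))%:E = (\prod_i m i)%:E)%E.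
  move=> H mf f0 fm; apply: (H (enum I)) => // i.
  by rewrite mem_enum.
elim=> [|e J IH] {}f {}m mf f0 fm fB.
  have /choice[B HB] : forall i, exists B, measurable B /\ f i = \1_B.
    by move=> i; have [B mB fiB] := fB i isT; exists B.
  have fE i : f i = \1_(B i) by case: (HB i).
  have mB i : measurable (B i) by case: (HB i).
  under eq_integral do (under eq_bigr do rewrite fE).
  rewrite integral_prod_indic//.
  by rewrite -prodEFin; apply: eq_bigr => i _; rewrite -fm fE.
have m0 i : 0 <= m i by rewrite -lee_fin -fm; apply: integral_ge0 => w _; rewrite lee_fin.
rewrite (bigD1 e)//= EFinM.
transitivity (\int[P]_w (f e (X e w) * (\prod_(i | i != e) f i (X i w)))%:E)%E.
  by apply: eq_integral => w _; rewrite (bigD1 e).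
rewrite (@ge0_integral_indicM _ _ _ _ _ P (distribution P (X e)) (X e)
   (fun w => \prod_(i | i != e) f i (X i w)) (\prod_(i | i != e) m i) (f e))//.
- by rewrite ge0_integral_distribution// ?fm//; [exact/measurable_EFinP|move=> y; rewrite lee_fin].
- exact: measurable_prod_RV.
- by move=> w; apply: prodr_ge0.
- exact: prodr_ge0.
move=> B mB.
rewrite -[Z in _ = (Z * _)%E]/(P (X e @^-1` B)).
(* Replacing the factor at [e] by the indicator of [B] shortens the list of general factors, so the
   induction hypothesis gives the premise of [ge0_integral_indicM]. *)
pose f' i := if i == e then \1_B else f i.
pose m' i := if i == e then fine (P (X e @^-1` B)) else m i.
have fin : P (X e @^-1` B) \is a fin_num.
  by apply: fin_num_measure; rewrite -[X in measurable X]setTI; exact: measurable_funP.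
have : (\int[P]_w (\prod_i f' i (X i w))%:E = (\prod_i m' i)%:E)%E.
  apply: IH.
  - by move=> i; rewrite /f'; case: ifP.
  - by move=> i x; rewrite /f'; case: ifP.
  - move=> i; rewrite /f' /m'; case: ifP => // /eqP ->.
    by rewrite integral_indic_comp// fineK.
  - move=> i iJ; rewrite /f'; case: ifPn => [_|ie]; first by exists B.
    by apply: fB; rewrite inE negb_or ie.
rewrite [in RHS](bigD1 e)//= {1}/m' eqxx => H.
rewrite -[P _]fineK// -EFinM.
have -> : \prod_(i | i != e) m i = \prod_(i | i != e) m' i.
  by apply: eq_bigr => i /negbTE ie; rewrite /m' ie.
rewrite -H; apply: eq_integral => w _.
rewrite [in RHS](bigD1 e)//= {1}/f' eqxx; congr (_ * _)%:E.
by apply: eq_bigr => i /negbTE ie; rewrite /f' ie.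
Qed.

Lemma integral_prod (f : I -> R -> R) (m : I -> R) :
  (forall i, measurable_fun setT (f i)) ->
  (forall i, P.-integrable setT (fun w => (f i (X i w))%:E)) ->
  (forall i, (\int[P]_w (f i (X i w))%:E = (m i)%:E)%E) ->
  P.-integrable setT (fun w => (\prod_i f i (X i w))%:E) /\
  (\int[P]_w (\prod_i f i (X i w))%:E = (\prod_i m i)%:E)%E.
Proof.
(* Induction on the set [J] of indices whose factor may change sign. *)
suff: forall (J : seq I) (f : I -> R -> R) (m : I -> R),
  (forall i, measurable_fun setT (f i)) ->
  (forall i, P.-integrable setT (fun w => (f i (X i w))%:E)) ->
  (forall i, (\int[P]_w (f i (X i w))%:E = (m i)%:E)%E) ->
  (forall i, i \notin J -> forall x, 0 <= f i x) ->
  P.-integrable setT (fun w => (\prod_i f i (X i w))%:E) /\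
  (\int[P]_w (\prod_i f i (X i w))%:E = (\prod_i m i)%:E)%E.
  move=> H mf f0 fm; apply: (H (enum I)) => // i.
  by rewrite mem_enum.
elim=> [|e J IH] {}f {}m mf fi fm f0.
  have E := ge0_integral_prod mf (fun i => f0 i isT) fm.
  split => //; apply/integrableP; split.
    by apply/measurable_EFinP; exact: measurable_prod_RV.
  rewrite (eq_integral (fun w => (\prod_i f i (X i w))%:E)).
    by rewrite E ltry.
  by move=> w _; rewrite gee0_abs// lee_fin prodr_ge0// => i _; exact: f0.
(* The factor at [e] is split into its positive part ([b = true]) and negative part ([b = false]).
   Both families fall under the induction hypothesis, and the claim is the difference of the two
   results. *)
pose fs (b : bool) i := if i == e then (if b then (f e)^\+ else (f e)^\-)%R else f i.
pose ms b i := fine (\int[P]_w (fs b i (X i w))%:E)%E.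
have mfs b i : measurable_fun setT (fs b i).
  rewrite /fs; case: ifP => // _; case: b.
    exact: measurable_funrpos.
  exact: measurable_funrneg.
have ifs b i : P.-integrable setT (fun w => (fs b i (X i w))%:E).
  rewrite /fs; case: ifP => // /eqP ->; case: b.
    have := integrable_funrpos measurableT (fi e).
    by apply: eq_integrable => //.
  have := integrable_funrneg measurableT (fi e).
  by apply: eq_integrable => //.
have Hms b i : (\int[P]_w (fs b i (X i w))%:E = (ms b i)%:E)%E.
  by rewrite fineK// integrable_fin_num.
have fs0 b i : i \notin J -> forall x, 0 <= fs b i x.
  move=> iJ x; rewrite /fs; case: ifPn => [_|ie]; last by apply: f0; rewrite inE negb_or ie.
  by case: b; [exact: funrpos_ge0|exact: funrneg_ge0].
have [i1 E1] := IH _ _ (mfs true) (ifs true) (Hms true) (fs0 true).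
have [i2 E2] := IH _ _ (mfs false) (ifs false) (Hms false) (fs0 false).
have fE w : \prod_i f i (X i w) = \prod_i fs true i (X i w) - \prod_i fs false i (X i w).
  rewrite (bigD1 e)//= [X in _ = X - _](bigD1 e)//= [X in _ = _ - X](bigD1 e)//=.
  rewrite /fs eqxx.
  rewrite [X in _ = _ * X - _](eq_bigr (fun i => f i (X i w))); last first.
    by move=> i /negbTE ->.
  rewrite [X in _ = _ - _ * X](eq_bigr (fun i => f i (X i w))); last first.
    by move=> i /negbTE ->.
  rewrite -mulrBl; congr (_ * _).
  by have /(congr1 (fun g => g (X e w))) := funrposBneg (f e).
have mE : \prod_i m i = \prod_i ms true i - \prod_i ms false i.
  rewrite (bigD1 e)//= [X in _ = X - _](bigD1 e)//= [X in _ = _ - X](bigD1 e)//=.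
  rewrite [X in _ = _ * X - _](eq_bigr (fun i => m i)); last first.
    by move=> i /negbTE ie; rewrite /ms /fs ie fm.
  rewrite [X in _ = _ - _ * X](eq_bigr (fun i => m i)); last first.
    by move=> i /negbTE ie; rewrite /ms /fs ie fm.
  rewrite -mulrBl; congr (_ * _); apply: EFin_inj.
  rewrite EFinB -fm -!Hms.
  rewrite -(integralB_EFin measurableT (ifs true e) (ifs false e)).
  apply: eq_integral => w _.
  rewrite -EFinB /fs eqxx; congr (_%:E).
  by have /(congr1 (fun g => g (X e w))) := funrposBneg (f e).
split.
  have := integrableB measurableT i1 i2; apply: eq_integrable => // w _ /=.
  by rewrite fE.
under eq_integral do rewrite fE EFinB.
by rewrite (integralB_EFin measurableT i1 i2) E1 E2 mE.
Qed.

End ProductFormula.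

(** * Transfer of moments from the common law to the entries *)

Section MomentTransfer.
Context {R : realType} d (Om : measurableType d) (P : probability Om R)
  (X : {RV P >-> R}) (F : probability (measurableTypeR R) R).
Hypothesis lawX : forall B, measurable B -> distribution P X B = F B.

(* [X] with the codomain carrying the display of [F]; the two measurable
   structures on the real line have the same measurable sets. *)
Let X' : Om -> measurableTypeR R := X.
Let mX' : measurable_fun setT X'. Proof. exact: (measurable_funP X). Qed.
Let X'_mixin := isMeasurableFun.Build _ _ _ _ _ mX'.
Let X'_pack : {RV P >-> measurableTypeR R} := HB.pack X' X'_mixin.

Let integral_eq (f : R -> R) :
  (\int[distribution P X'_pack]_x (f x)%:E = \int[F]_x (f x)%:E)%E.
Proof. by apply: eq_measure_integral => B mB _; exact: lawX. Qed.

Lemma ge0_integral_law (f : R -> R) : measurable_fun setT f ->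
  (forall x, 0 <= f x) -> (\int[P]_w (f (X w))%:E = \int[F]_x (f x)%:E)%E.
Proof.
move=> mf f0; rewrite -integral_eq ge0_integral_distribution//.
exact/measurable_EFinP.
Qed.

Lemma integral_law (f : R -> R) : measurable_fun setT f ->
  P.-integrable setT (fun w => (f (X w))%:E) ->
  (\int[P]_w (f (X w))%:E = \int[F]_x (f x)%:E)%E.
Proof.
move=> mf fi; rewrite -integral_eq integral_distribution//.
exact/measurable_EFinP.
Qed.

End MomentTransfer.

(** * Variance of quadratic forms *)

(** Collecting repeated indices turns a monomial into a product of powers of distinct variables, the
    form that [integral_prod] can evaluate. *)
Lemma prod_seq_count (R : comPzRingType) (I : finType) (s : seq I) (x : I -> R) :
  \prod_(a <- s) x a = \prod_i x i ^+ count_mem i s.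
Proof.
elim: s => [|a s IHs] /=; first by rewrite big_nil big1.
rewrite big_cons IHs (bigD1 a)//= [RHS](bigD1 a)//= eqxx add1n exprS mulrA.
by congr (_ * _); apply: eq_bigr => i /negbTE; rewrite eq_sym => ->.
Qed.

Lemma integral_lincomb d (Om : measurableType d) (R : realType)
    (P : probability Om R) (J : eqType) (s : seq J) (c m : J -> R)
    (f : J -> Om -> R) :
  {in s, forall j, P.-integrable setT (fun w => (f j w)%:E) /\
                   (\int[P]_w (f j w)%:E = (m j)%:E)%E} ->
  P.-integrable setT (fun w => (\sum_(j <- s) c j * f j w)%:E) /\
  (\int[P]_w (\sum_(j <- s) c j * f j w)%:E = (\sum_(j <- s) c j * m j)%:E)%E.
Proof.
elim: s => [_|j s IHs H].
  under eq_fun do rewrite big_nil.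
  by rewrite big_nil integral0; split => //; exact: integrable0.
have [fi fm] := H j (mem_head _ _).
have [si sm] : P.-integrable setT (fun w => (\sum_(j <- s) c j * f j w)%:E) /\
  (\int[P]_w (\sum_(j <- s) c j * f j w)%:E = (\sum_(j <- s) c j * m j)%:E)%E.
  by apply: IHs => k ks; apply: H; rewrite inE ks orbT.
have ci : P.-integrable setT (fun w => (c j)%:E * (f j w)%:E)%E.
  exact: integrableZl.
under eq_fun do rewrite big_cons EFinD EFinM.
split; first exact: integrableD.
by rewrite integralD// integralZl// fm sm big_cons EFinD EFinM.
Qed.

Section QuadraticForm.
Context d (Om : measurableType d) (R : realType) (P : probability Om R).
Context (I : finType) (X : I -> {RV P >-> R}) (nu4 : R).
Hypothesis indX : independent_RVs X.
Hypothesis EX1 : forall i, (\int[P]_w (X i w)%:E = 0)%E.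
Hypothesis EX2 : forall i, (\int[P]_w (X i w ^+ 2)%:E = 1)%E.
Hypothesis EX4 : forall i, (\int[P]_w (X i w ^+ 4)%:E = nu4%:E)%E.

Let mX i : measurable_fun setT (X i). Proof. exact: measurable_funP. Qed.

(** Domination by [1 + x ^+ 4]: the first term serves where [|x| <= 1], the second elsewhere. *)
Lemma integrable_pow4 i k : (k <= 4)%N ->
  P.-integrable setT (fun w => (X i w ^+ k)%:E).
Proof.
move=> k4.
have i4 : P.-integrable setT (fun w => (X i w ^+ 4)%:E).
  apply/integrableP; split; first exact/measurable_EFinP/measurable_funX.
  rewrite (eq_integral (fun w => (X i w ^+ 4)%:E)) ?EX4 ?ltry// => w _.
  by rewrite gee0_abs// lee_fin exprn_even_ge0.
have i1 : P.-integrable setT (fun w : Om => (1 : R)%:E).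
  exact: finite_measure_integrable_cst.
have := integrableD measurableT i1 i4; apply: le_integrable => //.
  exact/measurable_EFinP/measurable_funX.
move=> w _; rewrite -EFinD !abse_EFin lee_fin normrX.
rewrite [leRHS]ger0_norm ?addr_ge0 ?exprn_even_ge0//.
rewrite (_ : X i w ^+ 4 = `|X i w| ^+ 4); last by rewrite -normrX ger0_norm// exprn_even_ge0.
have [y1|/ltW y1] := leP `|X i w| 1.
  by rewrite (le_trans (exprn_ile1 _ _ _))// lerDl exprn_ge0.
by rewrite (le_trans (ler_weXn2l y1 k4))// lerDr.
Qed.

Let mu i k : R := fine (\int[P]_w (X i w ^+ k)%:E)%E.

Let muE i k : (k <= 4)%N -> (\int[P]_w (X i w ^+ k)%:E = (mu i k)%:E)%E.
Proof. by move=> k4; rewrite fineK// integrable_fin_num// integrable_pow4. Qed.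

Let mu0 i : mu i 0 = 1.
Proof.
rewrite /mu; under eq_integral do rewrite expr0.
by rewrite integral_cst//= probability_setT mul1e.
Qed.

Let mu1 i : mu i 1 = 0.
Proof. by rewrite /mu; under eq_integral do rewrite expr1; rewrite EX1. Qed.

Let mu2 i : mu i 2 = 1. Proof. by rewrite /mu EX2. Qed.

Let mu4 i : mu i 4 = nu4. Proof. by rewrite /mu EX4. Qed.

(** Expectation of the monomial with index list [s], by independence a product of moments of single
    variables. *)
Let mom (s : seq I) : R := \prod_i mu i (count_mem i s).

Let integral_monomial (s : seq I) : (size s <= 4)%N ->
  P.-integrable setT (fun w => (\prod_(a <- s) X a w)%:E) /\
  (\int[P]_w (\prod_(a <- s) X a w)%:E = (mom s)%:E)%E.
Proof.
move=> s4.
have c4 i : (count_mem i s <= 4)%N := leq_trans (count_size _ _) s4.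
under eq_fun do rewrite prod_seq_count.
apply: (@integral_prod _ _ _ _ _ _ indX
  (fun i x => x ^+ count_mem i s) (fun i => mu i (count_mem i s))).
- by move=> i; exact: measurable_funX.
- by move=> i; exact: integrable_pow4.
- by move=> i; exact: muE.
Qed.

Let mom_once (s : seq I) i : count_mem i s = 1%N -> mom s = 0.
Proof. by move=> s1; rewrite /mom (bigD1 i)//= s1 mu1 mul0r. Qed.

Let mom_even (s : seq I) :
  (forall i, (count_mem i s == 0%N) || (count_mem i s == 2%N)) -> mom s = 1.
Proof.
by move=> H; apply: big1 => i _; have /orP[/eqP->|/eqP->] := H i.
Qed.

Let mom_pair a b : mom [:: a; b] = (a == b)%:R.
Proof.
have [<-|ab] := eqVneq a b.
  by apply: mom_even => i /=; case: (a == i).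
by apply: (@mom_once _ a); rewrite /= eqxx eq_sym (negbTE ab).
Qed.

Let mom_all_eq a : mom [:: a; a; a; a] = nu4.
Proof.
rewrite /mom (bigD1 a)//= eqxx mu4 big1 ?mulr1// => i /negbTE.
by rewrite eq_sym => ->.
Qed.

Let nu4_ge0 (i : I) : 0 <= nu4.
Proof.
by rewrite -lee_fin -(EX4 i); apply: integral_ge0 => w _; rewrite lee_fin exprn_even_ge0.
Qed.

(** Covariance of the products of variables indexed by [p] and by [r], expanded into moments. *)
Let cov (p r : I * I) : R :=
  mom [:: p.1; p.2; r.1; r.2] - (r.1 == r.2)%:R * mom [:: p.1; p.2]
  - (p.1 == p.2)%:R * mom [:: r.1; r.2] + (p.1 == p.2)%:R * (r.1 == r.2)%:R.

Let swap (p : I * I) := (p.2, p.1).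

Let neqF (a b : I) : a != b -> ((a == b) = false) * ((b == a) = false).
Proof. by rewrite (eq_sym b) => /negbTE ->. Qed.

(** A moment vanishes as soon as some index occurs exactly once, and two distinct diagonal pairs
    have covariance [1 - 1 - 1 + 1 = 0]. Hence only [r = p] and [r = swap p] survive, with
    covariance 1 if the two indices differ and [nu4 - 1] if all four agree. *)
Let cov_le (p r : I * I) :
  `|cov p r| <= (nu4 + 1) * ((r == p)%:R + (r == swap p)%:R).
Proof.
case: p r => a b [c e]; rewrite /cov /swap /= !mom_pair !xpair_eqE.
have [ab|ab] := eqVneq a b; [subst b|].
  have [ce|ce] := eqVneq c e; [subst e|].
    rewrite !mul1r subrK andbb.
    have [ca|ca] := eqVneq c a; [subst c|].
      rewrite mom_all_eq /=; have := nu4_ge0 a; rewrite -subr_ge0 ler_norml => ?.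
      by apply/andP; split; lra.
    rewrite mom_even ?subrr ?normr0 ?addr0 ?mulr0// => i /=.
    have [ai|ai] := eqVneq a i; [subst i|]; first by rewrite !(neqF ca).
    by case: (c == i).
  rewrite !mul0r !mulr0 subr0 subr0 addr0.
  rewrite (_ : mom _ = 0) ?normr0; last first.
    have [ca|ca] := eqVneq c a; [subst c|].
      by apply: (@mom_once _ e); rewrite /= eqxx !(neqF ce).
    by apply: (@mom_once _ c); rewrite /= eqxx !(neqF ca) !(neqF ce).
  by rewrite mulr_ge0 ?addr_ge0// nu4_ge0.
(* For [a != b] the pair [(a, b)] has mean 0, so only the fourth-order moment is left. *)
rewrite mulr0 !mul0r !subr0 addr0.
have H0 : mom [:: a; b; c; e] = 0 ->
   `|mom [:: a; b; c; e]| <= (nu4 + 1) *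
     (((c == a) && (e == b))%:R + ((c == b) && (e == a))%:R).
  by move=> ->; rewrite normr0 mulr_ge0 ?addr_ge0// nu4_ge0.
have [ca|ca] := eqVneq c a; [subst c|].
  have [eb|eb] := eqVneq e b; [subst e|].
    rewrite mom_even ?normr1; last first.
      move=> i /=; have [ai|ai] := eqVneq a i; [subst i|]; first by rewrite !(neqF ab).
      by case: (b == i).
    by have := nu4_ge0 a; rewrite !(neqF ab) /=; lra.
  have := H0 _; rewrite eqxx !(neqF eb) !(neqF ab); apply.
  by apply: (@mom_once _ b); rewrite /= eqxx !(neqF eb) !(neqF ab).
have [ea|ea] := eqVneq e a; [subst e|].
  have [cb|cb] := eqVneq c b; [subst c|].
    rewrite mom_even ?normr1; last first.
      move=> i /=; have [ai|ai] := eqVneq a i; [subst i|]; first by rewrite !(neqF ab).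
      by case: (b == i).
    by have := nu4_ge0 a; rewrite /=; lra.
  have := H0 _; rewrite eqxx !(neqF cb) !(neqF ca); apply.
  by apply: (@mom_once _ b); rewrite /= eqxx !(neqF cb) !(neqF ab).
have := H0 _; rewrite !(neqF ca) !(neqF ea) andbF; apply.
by apply: (@mom_once _ a); rewrite /= eqxx !(neqF ab) !(neqF ca) !(neqF ea).
Qed.

Let y (p : I * I) w : R := X p.1 w * X p.2 w - (p.1 == p.2)%:R.

Let integral_cov (p r : I * I) :
  P.-integrable setT (fun w => (y p w * y r w)%:E) /\
  (\int[P]_w (y p w * y r w)%:E = (cov p r)%:E)%E.
Proof.
(* The four terms of the expanded product, each a coefficient with an index list; the empty list
   stands for the constant. *)
pose s : seq (R * seq I) := [:: (1, [:: p.1; p.2; r.1; r.2]);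
  (- (r.1 == r.2)%:R, [:: p.1; p.2]); (- (p.1 == p.2)%:R, [:: r.1; r.2]);
  ((p.1 == p.2)%:R * (r.1 == r.2)%:R, [::])].
have := @integral_lincomb _ _ _ P _ s fst (fun j => mom j.2)
  (fun j w => \prod_(a <- j.2) X a w).
rewrite (_ : (fun w => (\sum_(j <- s) _)%:E) = fun w => (y p w * y r w)%:E); last first.
  by apply/funext => w; rewrite /s !big_cons !big_nil /= /y; congr (_%:E); ring.
rewrite (_ : \sum_(j <- s) _ = cov p r); last first.
  rewrite /s !big_cons big_nil /= /cov.
  have -> : mom [::] = 1 by apply: mom_even.
  ring.
by apply=> j; rewrite !inE => /or4P[] /eqP -> /=; exact: integral_monomial.
Qed.

(** The expanded square is a double sum weighted by [cov]. By [cov_le] each [p] contributes at most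
    [Q p ^+ 2 + |Q p| |Q (swap p)|] times [nu4 + 1]; the inequality between arithmetic and geometric
    means, and invariance of the sum under [swap], give the factor 2. *)
Lemma quadratic_form_variance (Q : I * I -> R) :
  P.-integrable setT (fun w =>
    ((\sum_p Q p * (X p.1 w * X p.2 w - (p.1 == p.2)%:R)) ^+ 2)%:E) /\
  (\int[P]_w ((\sum_p Q p * (X p.1 w * X p.2 w - (p.1 == p.2)%:R)) ^+ 2)%:E
    <= (2 * (nu4 + 1) * \sum_p Q p ^+ 2)%:E)%E.
Proof.
pose s := index_enum {: (I * I) * (I * I)}.
have := @integral_lincomb _ _ _ P _ s (fun j => Q j.1 * Q j.2)
  (fun j => cov j.1 j.2) (fun j w => y j.1 w * y j.2 w).
rewrite (_ : (fun w => (\sum_(j <- s) _)%:E) =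
   fun w => ((\sum_p Q p * y p w) ^+ 2)%:E); last first.
  apply/funext => w; congr (_%:E).
  rewrite expr2 big_distrlr/= pair_bigA/=.
  by apply: eq_bigr => j _; rewrite mulrACA.
move=> [j _|i e]; first exact: integral_cov.
split; [exact: i|rewrite e lee_fin].
rewrite -(pair_bigA _ (fun p r => Q p * Q r * cov p r))/=.
(* An element of [I] is needed to know that [nu4] is nonnegative; for empty [I] both sides are 0. *)
have [p0 _|p0] := pickP [pred p : I * I | true]; last first.
  by rewrite !big1 ?mulr0// => p; have := p0 p.
have nu0 : 0 <= nu4 + 1 by rewrite addr_ge0// (nu4_ge0 p0.1).
have sw : \sum_p Q (swap p) ^+ 2 = \sum_p Q p ^+ 2.
  rewrite [RHS](reindex_inj (h := swap))//.
  by move=> [a b] [a' b'] [-> ->].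
apply: (@le_trans _ _ (\sum_p (nu4 + 1) * (Q p ^+ 2 + `|Q p| * `|Q (swap p)|))).
  apply: ler_sum => p _.
  apply: (@le_trans _ _ (\sum_r `|Q p| * `|Q r| * ((nu4 + 1) * ((r == p)%:R + (r == swap p)%:R)))).
    apply: ler_sum => r _; rewrite (le_trans (ler_norm _))// !normrM.
    by rewrite ler_wpM2l ?mulr_ge0//; exact: cov_le.
  have D (c : I * I -> R) x : \sum_r c r * (r == x)%:R = c x.
    rewrite (bigD1 x)//= eqxx mulr1 big1 ?addr0// => r /negbTE ->.
    by rewrite mulr0.
  under eq_bigr do rewrite mulrCA mulrDr.
  by rewrite -mulr_sumr ler_wpM2l// big_split/= !D -normrM ger0_norm -expr2 ?sqr_ge0.
rewrite -mulr_sumr [2 * _]mulrC -mulrA ler_wpM2l// big_split/= mulr_natl mulr2n lerD2l.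
have sq p : Q p ^+ 2 = `|Q p| ^+ 2 by rewrite -normrX ger0_norm ?sqr_ge0.
apply: (@le_trans _ _ (\sum_p (Q p ^+ 2 + Q (swap p) ^+ 2) / 2)).
  by apply: ler_sum => p _; rewrite !sq; have := sqr_ge0 (`|Q p| - `|Q (swap p)|); lra.
by rewrite -mulr_suml big_split/= sw; lra.
Qed.

End QuadraticForm.

(** * Spectrum of real symmetric matrices *)

Lemma char_poly_conj (R : comUnitRingType) n (P D : 'M[R]_n) :
  P \in unitmx -> char_poly (invmx P *m D *m P) = char_poly D.
Proof.
move=> uP; rewrite /char_poly /char_poly_mx.
pose Q := map_mx (@polyC R) P; pose Q' := map_mx (@polyC R) (invmx P).
have QQ : Q' *m Q = 1%:M by rewrite -map_mxM mulVmx// map_mx1.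
have -> : 'X%:M - map_mx (@polyC R) (invmx P *m D *m P) =
   Q' *m ('X%:M - map_mx (@polyC R) D) *m Q.
  rewrite !map_mxM mulmxBr mulmxBl -/Q -/Q'; congr (_ - _).
  by rewrite scalar_mxC -mulmxA QQ mulmx1.
by rewrite !det_mulmx mulrAC -det_mulmx QQ det1 mul1r.
Qed.

Section Spectrum.
Context {R : realType}.

(** Over the complex numbers the matrix becomes Hermitian, hence unitarily diagonalisable with real
    diagonal entries. Their real parts form [s], and the identities descend by injectivity of the
    embedding. *)
Lemma symmetric_spectrum n (A : 'M[R]_n) : A^T = A ->
  exists s : seq R, [/\ char_poly A = \prod_(x <- s) ('X - x%:P), size s = n &
    \tr (A *m A) = \sum_(x <- s) x ^+ 2].
Proof.
move=> sA.
pose toC := real_complex R; pose B := map_mx toC A.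
have hB : B \is hermsymmx.
  apply: realsym_hermsym.
    apply/is_hermitianmxP; rewrite expr0 scale1r map_mx_id//.
    by rewrite /B map_trmx sA.
  by apply/mxOverP => i j; rewrite mxE complex_real.
have /orthomx_spectralP := hermitian_normalmx hB.
have /mxOverP rD := hermitian_spectral_diag_real hB.
have := spectral_unit B.
set P := spectralmx B in rD *; set D := spectral_diag B in rD * => uP BE.
pose r i : R := complex.Re (D 0 i).
have rE i : toC (r i) = D 0 i by apply: RRe_real.
exists [seq r i | i <- enum 'I_n]; split.
- apply: (@map_poly_inj _ _ toC).
  rewrite map_char_poly -/B BE char_poly_conj// char_poly_trig ?diag_mx_is_trig//.
  rewrite big_map big_enum/= rmorph_prod/=; apply: eq_bigr => i _.
  by rewrite rmorphB/= map_polyX map_polyC/= mxE eqxx mulr1n -rE.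
- by rewrite size_map size_enum_ord.
- apply: complexI; rewrite -[LHS]/(toC _) -[RHS]/(toC _).
  have -> : toC (\tr (A *m A)) = \tr (B *m B).
    by rewrite -map_mxM trace_map_mx.
  rewrite {1 2}BE -!mulmxA mulKVmx// mxtrace_mulC !mulmxA mulmxK//.
  rewrite mulmx_diag mxtrace_diag big_map big_enum/=. rewrite /toC rmorph_sum/=.
  by apply: eq_bigr => i _; rewrite mxE -!rE expr2 /toC rmorphM.
Qed.

(** Since the characteristic polynomial splits over the reals, [eigvals] is a rearrangement of the
    list from [symmetric_spectrum]: distinct roots are the elements of [undup s], multiplicities
    their numbers of occurrences. *)
Lemma lin_eig_stat_symmetric n (A : 'M[R]_n) : A^T = A ->
  lin_eig_stat (fun x => x ^+ 2) A = \tr (A *m A).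
Proof.
move=> /symmetric_spectrum[s [pE _ ->]]; rewrite /lin_eig_stat /eigvals.
set p := char_poly A.
have p0 : p != 0 by rewrite monic_neq0// char_poly_monic.
rewrite big_flatten/= big_map.
rewrite (perm_big (undup s))/=.
  rewrite -[RHS]big_undup_iterop_count; apply: eq_bigr => x _.
  by rewrite /p pE mu_prod_XsubC big_nseq Monoid.iteropE.
apply: uniq_perm; rewrite ?undup_uniq//.
  by apply: (sorted_uniq lt_trans ltxx); exact: sorted_roots.
move=> x; rewrite mem_undup.
have := roots_onP (roots_on_rootsR p0).
move=> /(_ x); rewrite in_itv/= => /(_ isT) <-.
by rewrite /p pE root_prod_XsubC.
Qed.

Lemma trace_sq_le n (A : 'M[R]_n) (C : R) : A^T = A ->
  (forall a, eigenvalue A a -> `|a| <= C) -> \tr (A *m A) <= n%:R * C ^+ 2.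
Proof.
move=> /symmetric_spectrum[s [pE sn ->]] HC.
rewrite -sn -sum1_size natr_sum mulr_suml big_seq [leRHS]big_seq.
apply: ler_sum => x xs; rewrite mul1r -[x ^+ 2]ger0_norm ?sqr_ge0// normrX.
rewrite lerXn2r ?nnegrE//.
  rewrite (le_trans (normr_ge0 x))//.
all: by apply: HC; rewrite eigenvalue_root_char pE root_prod_XsubC.
Qed.

(** If [v] is an eigenvector of [A], then [e *t v] with a unit vector [e] is one of the tensor
    product. This carries the eigenvalue bound assumed for the tensor product over to the column
    covariance matrix. *)
Lemma eigenvalue_tens1 m n (A : 'M[R]_n) a :
  eigenvalue A a -> eigenvalue ((1%:M : 'M[R]_m.+1) *t A) a.
Proof.
move=> /eigenvalueP[v vA v0]; apply/eigenvalueP.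
pose e : 'rV[R]_m.+1 := delta_mx 0 0.
have ev : (e *t v) *m ((1%:M : 'M[R]_m.+1) *t A) = a *: (e *t v).
  by rewrite tensmx_mul mulmx1 vA; apply/matrixP => i j; rewrite !mxE mulrCA.
exists (e *t v); first exact: ev.
apply: contra_neq v0 => ev0; apply/rowP => j.
have := congr1 (fun M : 'M[R]_(1, (m.+1 * n)%N) => M 0 (mxtens_index (0, j))) ev0.
by rewrite !mxE mxtens_indexK /= !ord1 mul1r.
Qed.

End Spectrum.

(** * Traces and Frobenius norms *)

Section FrobeniusIdentities.
Context {R : realType}.

Lemma sqr_sum_le n (a : 'I_n -> R) : (\sum_i a i) ^+ 2 <= n%:R * \sum_i a i ^+ 2.
Proof.
rewrite expr2 big_distrlr/=.
apply: (@le_trans _ _ (\sum_i \sum_j (a i ^+ 2 + a j ^+ 2) / 2)).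
  apply: ler_sum => i _; apply: ler_sum => j _.
  by have := sqr_ge0 (a i - a j); lra.
have E i : \sum_j (a i ^+ 2 + a j ^+ 2) / 2 = (n%:R * a i ^+ 2 + \sum_j a j ^+ 2) / 2.
  by rewrite -mulr_suml big_split/= sumr_const card_ord mulr_natl.
rewrite (eq_bigr _ (fun i _ => E i)) -mulr_suml big_split/= sumr_const card_ord.
by rewrite -mulr_sumr -mulr_natl; lra.
Qed.

Lemma trace_mul_sym n (A : 'M[R]_n) : A^T = A ->
  \tr (A *m A) = \sum_i \sum_j A i j ^+ 2.
Proof.
move=> sA; rewrite /mxtrace; apply: eq_bigr => i _; rewrite mxE.
by apply: eq_bigr => j _; rewrite -{2}sA mxE expr2.
Qed.

Lemma sum_diag_sqr_le n (A : 'M[R]_n) : A^T = A ->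
  \sum_i A i i ^+ 2 <= \tr (A *m A).
Proof.
move=> sA; rewrite trace_mul_sym//; apply: ler_sum => i _.
by rewrite (bigD1 i)//= lerDl sumr_ge0// => j _; exact: sqr_ge0.
Qed.

(** Cauchy-Schwarz on the diagonal, whose squares are part of the squared Frobenius norm. *)
Lemma sqr_trace_le n (A : 'M[R]_n) : A^T = A ->
  (\tr A) ^+ 2 <= n%:R * \tr (A *m A).
Proof.
move=> sA; rewrite (le_trans (sqr_sum_le _))// ler_wpM2l//.
exact: sum_diag_sqr_le.
Qed.

Lemma gram_sym m n (A : 'M[R]_(m, n)) : (A *m A^T)^T = A *m A^T.
Proof. by rewrite trmx_mul trmxK. Qed.

Lemma invsqrtmx_sym n (A : 'M[R]_n) : (invsqrtmx A)^T = invsqrtmx A.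
Proof.
rewrite /invsqrtmx trmx_inv; congr invmx; rewrite /sqrtmx.
(* Both outcomes of [xget] are symmetric: a positive definite root, and the default value 0. *)
by case: xgetP => [B _ [[]]//|_]; rewrite trmx0.
Qed.

(** Summing [(x + d)^2 >= x^2 / 2 - d^2] over the entries [x] of [M - 1] and [d] of [W - M] leaves
    more than [D / 2 - D / 4]. *)
Lemma frobenius_perturb n (W M : 'M[R]_n) (D : R) :
  W^T = W -> M^T = M ->
  \tr ((M - 1%:M) *m (M - 1%:M)) = D ->
  \sum_i \sum_j (W i j - M i j) ^+ 2 < D / 4 ->
  D / 4 <= \tr ((W - 1%:M) *m (W - 1%:M)).
Proof.
move=> sW sM; have s1 (Z : 'M[R]_n) : Z^T = Z -> (Z - 1%:M)^T = Z - 1%:M.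
  by move=> sZ; rewrite linearB/= sZ trmx1.
rewrite !trace_mul_sym ?s1// => <- H.
set D' := \sum_i \sum_j (M - 1%:M) i j ^+ 2 in H *.
suff : D' / 2 - \sum_i \sum_j (W i j - M i j) ^+ 2 <=
   \sum_i \sum_j (W - 1%:M) i j ^+ 2 by lra.
rewrite /D' mulr_suml -sumrB; apply: ler_sum => i _.
rewrite mulr_suml -sumrB; apply: ler_sum => j _.
rewrite !mxE; set a := M i j; set b := W i j; set e := _ *+ _.
(* The difference of the two sides is half the square of [x + 2 d]. *)
by have := sqr_ge0 (a - e + 2 * (b - a)); nra.
Qed.

(** Here [tr M = tr (M - 1) + n]. The square of the first term is at most [n D] by Cauchy-Schwarz,
    and [n ^ 2 <= n D / c] by the lower bound on [D]. *)
Lemma sqr_trace_le_alternative n (M : 'M[R]_n) (c : R) : M^T = M -> 0 < c ->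
  let D := \tr ((M - 1%:M) *m (M - 1%:M)) in
  n%:R * c <= D -> (\tr M) ^+ 2 <= 2 * (1 + c^-1) * n%:R * D.
Proof.
move=> sM c0 D cD.
have sM1 : (M - 1%:M)^T = M - 1%:M by rewrite linearB/= sM trmx1.
have := sqr_trace_le sM1; rewrite -/D linearB/= mxtrace1 => H.
have H2 : n%:R ^+ 2 <= n%:R * (c^-1 * D).
  by rewrite expr2 ler_wpM2l// ler_pdivlMl// mulrC.
(* This square encodes [(tr M)^2 <= 2 (tr M - n)^2 + 2 n^2]. *)
have := sqr_ge0 (\tr M - 2 * n%:R).
rewrite (_ : 2 * (1 + c^-1) * n%:R * D = 2 * (n%:R * D) + 2 * (n%:R * (c^-1 * D))); last by ring.
by nra.
Qed.

End FrobeniusIdentities.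

(** * Sample covariance matrices *)

Section SampleCovariance.
Context {R : realType} (p T q : nat).
Notation I := ('I_T * 'I_p * 'I_q)%type.

Lemma big_triple (F : I -> R) :
  \sum_a F a = \sum_t \sum_k \sum_m F (t, k, m).
Proof.
rewrite pair_bigA/= pair_bigA/=.
by apply: eq_bigr => -[[]].
Qed.

Lemma big_triple_pair (F : I * I -> R) :
  \sum_r (r.1.1.1 == r.2.1.1)%:R * F r =
  \sum_t \sum_k \sum_m \sum_l \sum_n F ((t, k, m), (t, l, n)).
Proof.
transitivity (\sum_(a : I) \sum_(b : I) (a.1.1 == b.1.1)%:R * F (a, b)).
  by rewrite pair_bigA/=; apply: eq_bigr => -[].
rewrite big_triple; apply: eq_bigr => t0 _; do 2 (apply: eq_bigr => ? _).
rewrite big_triple (bigD1 t0)//= [X in _ + X]big1 ?addr0.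
  by do 2 (apply: eq_bigr => ? _); rewrite eqxx mul1r.
move=> t /negbTE ti; do 2 (apply: big1 => ? _).
by rewrite eq_sym ti mul0r.
Qed.

(** Coefficient of [x r.1 * x r.2] in entry [(i, j)] of the unnormalised sample covariance; the
    leading factor says that only pairs taken from the same data matrix interact. *)
Definition quad_coef (A : 'M[R]_p) (V : 'M[R]_q) i j (r : I * I) : R :=
  (r.1.1.1 == r.2.1.1)%:R *
  (A i r.1.1.2 * A j r.2.1.2 * (V^T *m V) r.1.2 r.2.2).

Lemma sample_cov_entry (A : 'M[R]_p) (V : 'M[R]_q) (x : I -> R) i j :
  (\sum_t (A *m (\matrix_(k, m) x (t, k, m)) *m V^T) *m
          (A *m (\matrix_(k, m) x (t, k, m)) *m V^T)^T) i j =
  \sum_r quad_coef A V i j r * (x r.1 * x r.2).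
Proof.
under [RHS]eq_bigr do rewrite -mulrA.
rewrite big_triple_pair/= summxE; apply: eq_bigr => t _.
set Xt := \matrix_(_, _) _.
rewrite trmx_mul trmxK mulmxA -[X in X *m _]mulmxA mxE.
under [LHS]eq_bigr do rewrite mxE mulr_suml.
rewrite exchange_big/= [RHS]exchange_big/=; apply: eq_bigr => m _.
under [RHS]eq_bigr do rewrite exchange_big/=.
rewrite [RHS]exchange_big/=; apply: eq_bigr => n _.
rewrite !mxE !mulr_suml; apply: eq_bigr => k _.
rewrite mulr_sumr; apply: eq_bigr => l _.
by rewrite !mxE; ring.
Qed.

(** For uncorrelated standardised variables this is the mean of the entry. *)
Lemma quad_coef_diag (A : 'M[R]_p) (V : 'M[R]_q) i j :
  \sum_r quad_coef A V i j r * (r.1 == r.2)%:R =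
  T%:R * \tr (V *m V^T) * (A *m A^T) i j.
Proof.
transitivity (\sum_(a : I) \sum_(b : I) quad_coef A V i j (a, b) * (a == b)%:R).
  by rewrite pair_bigA/=; apply: eq_bigr => -[].
transitivity (\sum_a quad_coef A V i j (a, a)).
  apply: eq_bigr => a _; rewrite (bigD1 a)//= eqxx mulr1 big1 ?addr0// => b.
  by rewrite eq_sym => /negbTE ->; rewrite mulr0.
rewrite big_triple /quad_coef /=.
under eq_bigr do (under eq_bigr do (under eq_bigr do rewrite eqxx mul1r)).
rewrite sumr_const card_ord -[LHS]mulr_natl -mulrA; congr (_ * _).
rewrite mxtrace_mulC mxE mulr_sumr; apply: eq_bigr => k _.
by rewrite [A^T _ _]mxE -mulr_sumr mulrC.
Qed.

(** The sum of squares factors over the row indices, giving two diagonal entries of [A *m A^T], and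
    over the column indices, giving the squared Frobenius norm of [V^T *m V], which equals that of
    [V *m V^T]. *)
Lemma quad_coef_sqr (A : 'M[R]_p) (V : 'M[R]_q) i j :
  \sum_r quad_coef A V i j r ^+ 2 =
  T%:R * \tr ((V *m V^T) *m (V *m V^T)) * ((A *m A^T) i i * (A *m A^T) j j).
Proof.
transitivity (\sum_(r : I * I) (r.1.1.1 == r.2.1.1)%:R *
  (A i r.1.1.2 ^+ 2 * A j r.2.1.2 ^+ 2 * (V^T *m V) r.1.2 r.2.2 ^+ 2)).
  by apply: eq_bigr => r _; rewrite /quad_coef !exprMn; case: (_ == _); rewrite ?expr1n// expr0n.
rewrite big_triple_pair/= sumr_const card_ord -[LHS]mulr_natl -mulrA; congr (_ * _).
have -> : \tr ((V *m V^T) *m (V *m V^T)) = \sum_m \sum_n (V^T *m V) m n ^+ 2.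
  rewrite -trace_mul_sym ?trmx_mul ?trmxK//.
  by rewrite mulmxA mxtrace_mulC !mulmxA.
have dE k : (A *m A^T) k k = \sum_l A k l ^+ 2.
  by rewrite mxE; apply: eq_bigr => l _; rewrite mxE expr2.
rewrite !dE exchange_big/= [RHS]mulr_suml; apply: eq_bigr => m _.
under eq_bigr do (under eq_bigr do rewrite -mulr_sumr).
under eq_bigr do rewrite -mulr_suml -mulr_sumr.
by rewrite -mulr_suml -mulr_suml mulrC.
Qed.

End SampleCovariance.

(** * Concentration of the sample covariance at fixed dimensions *)

Section FixedSize.
Context {R : realType} (p T q : nat) d (Om : measurableType d)
  (P : probability Om R) (X : 'I_T -> 'I_p -> 'I_q -> {RV P >-> R}) (nu4 : R).
Notation I := ('I_T * 'I_p * 'I_q)%type.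
Let Xi (k : I) : {RV P >-> R} := X k.1.1 k.1.2 k.2.
Hypothesis indX : independent_RVs Xi.
Hypothesis EX1 : forall t i j, (\int[P]_w (X t i j w)%:E = 0)%E.
Hypothesis EX2 : forall t i j, (\int[P]_w (X t i j w ^+ 2)%:E = 1)%E.
Hypothesis EX4 : forall t i j, (\int[P]_w (X t i j w ^+ 4)%:E = nu4%:E)%E.
Hypotheses (T0 : (0 < T)%N) (q0 : (0 < q)%N).

Variables (A : 'M[R]_p) (V : 'M[R]_q).
Hypothesis trV : \tr (V *m V^T) = q%:R.

Let N : R := (T * q)%:R.

Definition sample_cov (w : Om) : 'M[R]_p :=
  N^-1 *: \sum_t (A *m (\matrix_(i, j) X t i j w) *m V^T) *m
                 (A *m (\matrix_(i, j) X t i j w) *m V^T)^T.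

Let M : 'M[R]_p := A *m A^T.

Let N0 : 0 < N. Proof. by rewrite ltr0n muln_gt0 T0 q0. Qed.

(** By [quad_coef_diag] and the normalisation [trV] the subtracted means add up to exactly [M i j],
    so the deviation is a centred quadratic form. *)
Lemma sample_cov_centered w i j : sample_cov w i j - M i j =
  \sum_(r : I * I) N^-1 * quad_coef A V i j r * (Xi r.1 w * Xi r.2 w - (r.1 == r.2)%:R).
Proof.
under [RHS]eq_bigr do rewrite -mulrA mulrBr.
rewrite -mulr_sumr sumrB quad_coef_diag mulrBr trV -natrM mulKf ?gt_eqF//.
rewrite /sample_cov mxE; congr (_ * _ - _).
exact: (sample_cov_entry A V (fun k => Xi k w)).
Qed.

Lemma measurable_sample_cov i j : measurable_fun setT (fun w => sample_cov w i j).
Proof.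
rewrite (_ : (fun w => _) = fun w => M i j +
  \sum_(r : I * I) N^-1 * quad_coef A V i j r * (Xi r.1 w * Xi r.2 w - (r.1 == r.2)%:R)).
  apply: measurable_funD => //; apply: measurable_sum => r.
  apply: measurable_funM => //; apply: measurable_funB => //.
  by apply: measurable_funM; exact: measurable_funP.
by apply/funext => w; rewrite -sample_cov_centered addrC subrK.
Qed.

Definition sample_cov_dist w : R := \sum_i \sum_j (sample_cov w i j - M i j) ^+ 2.

Lemma measurable_sample_cov_dist : measurable_fun setT sample_cov_dist.
Proof.
do 2 (apply: measurable_sum => ?).
by apply: measurable_funX; apply: measurable_funB => //; exact: measurable_sample_cov.
Qed.

(** The variance bound for entry [(i, j)] is proportional to [M i i * M j j], and these products sum
    to the squared trace. *)
Lemma expected_sample_cov_dist :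
  (\int[P]_w (sample_cov_dist w)%:E <=
   (2 * (nu4 + 1) * (T%:R / N ^+ 2) * \tr ((V *m V^T) *m (V *m V^T)) * (\tr M) ^+ 2)%:E)%E.
Proof.
have H i j : P.-integrable setT (fun w => ((sample_cov w i j - M i j) ^+ 2)%:E) /\
  (\int[P]_w ((sample_cov w i j - M i j) ^+ 2)%:E <=
   (2 * (nu4 + 1) * \sum_(r : I * I) (N^-1 * quad_coef A V i j r) ^+ 2)%:E)%E.
  have := @quadratic_form_variance _ _ _ P _ Xi nu4 indX (fun k => EX1 _ _ _)
    (fun k => EX2 _ _ _) (fun k => EX4 _ _ _) (fun r => N^-1 * quad_coef A V i j r).
  rewrite (_ : (fun w => _) = fun w => ((sample_cov w i j - M i j) ^+ 2)%:E)//.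
  by apply/funext => w; rewrite sample_cov_centered.
rewrite (_ : \int[P]_w _ = \int[P]_w (\sum_(ij : 'I_p * 'I_p)
   ((sample_cov w ij.1 ij.2 - M ij.1 ij.2) ^+ 2)%:E))%E; last first.
  by apply: eq_integral => w _; rewrite /sample_cov_dist pair_bigA/= sumEFin.
rewrite integral_sum//; last first.
  by move=> ij; have [] := H ij.1 ij.2.
apply: (@le_trans _ _ (\sum_(ij : 'I_p * 'I_p)
  (2 * (nu4 + 1) * (T%:R / N ^+ 2) *
   \tr ((V *m V^T) *m (V *m V^T)) * (M ij.1 ij.1 * M ij.2 ij.2))%:E)%E).
  apply: lee_sum => ij _; have [_] := H ij.1 ij.2.
  move=> /le_trans; apply; rewrite lee_fin.
  under eq_bigr do rewrite exprMn.
  rewrite -mulr_sumr quad_coef_sqr exprVn -/M.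
  by rewrite le_eqVlt; apply/orP; left; apply/eqP; ring.
rewrite sumEFin lee_fin -mulr_sumr.
rewrite -(pair_bigA _ (fun i j => M i i * M j j))/=.
suff -> : (\tr M) ^+ 2 = \sum_i \sum_j M i i * M j j by [].
by rewrite expr2 /mxtrace big_distrlr.
Qed.

Variables (c C2 : R).
Let D := \tr ((M - 1%:M) *m (M - 1%:M)).
Hypotheses (p0 : (0 < p)%N) (c0 : 0 < c) (cD : p%:R * c <= D).
Hypothesis trV2 : \tr ((V *m V^T) *m (V *m V^T)) <= q%:R * C2.

Lemma sample_cov_dist_tail :
  (P [set w | (D / 4 <= sample_cov_dist w)%R] <=
   (16 * (nu4 + 1) * (1 + c^-1) * C2 * (p%:R / N))%:E)%E.
Proof.
have D0 : 0 < D by rewrite (lt_le_trans _ cD)// mulr_gt0// ltr0n.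
have nu0 : 0 <= nu4.
  rewrite -lee_fin -(EX4 (Ordinal T0) (Ordinal p0) (Ordinal q0)).
  by apply: integral_ge0 => w _; rewrite lee_fin exprn_even_ge0.
have d0 w : 0 <= sample_cov_dist w.
  by do 2 (apply: sumr_ge0 => ? _); exact: sqr_ge0.
have := @le_integral_abse _ _ _ P setT measurableT (EFin \o sample_cov_dist) (D / 4)
  _ _.
rewrite setTI => H.
(* Markov's inequality at level [D / 4]. *)
have {}H : ((D / 4)%:E * P [set w | (D / 4 <= sample_cov_dist w)%R] <=
   \int[P]_w (sample_cov_dist w)%:E)%E.
  have := H ((measurable_EFinP _ _).2 measurable_sample_cov_dist) (divr_gt0 D0 (ltr0n _ 4)).
  rewrite (_ : [set x | _] = [set w | (D / 4 <= sample_cov_dist w)%R]); last first.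
    by apply/seteqP; split=> w /=; rewrite ger0_norm// lee_fin.
  rewrite (_ : integral _ _ _ = \int[P]_w (sample_cov_dist w)%:E)%E; last first.
    by apply: eq_integral => w _ /=; rewrite ger0_norm.
  by apply.
rewrite -(@lee_pmul2l _ (D / 4)%:E)//; last by rewrite lte_fin divr_gt0.
apply: (le_trans H); apply: (le_trans expected_sample_cov_dist).
rewrite -EFinM lee_fin.
have trM := sqr_trace_le_alternative (gram_sym A) c0 cD.
rewrite -/M -/D in trM.
have tr2 : 0 <= \tr ((V *m V^T) *m (V *m V^T)).
  by rewrite trace_mul_sym ?gram_sym//; do 2 (apply: sumr_ge0 => ? _); exact: sqr_ge0.
apply: (@le_trans _ _ (2 * (nu4 + 1) * (T%:R / N ^+ 2) * (q%:R * C2) *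
   (2 * (1 + c^-1) * p%:R * D))).
  rewrite ler_pM ?sqr_ge0//.
    by rewrite !mulr_ge0 ?addr_ge0 ?invr_ge0 ?sqr_ge0.
  by rewrite ler_wpM2l// !mulr_ge0 ?addr_ge0 ?invr_ge0 ?sqr_ge0.
(* The factor [D] cancels, which makes the bound uniform in the alternative; 16 is [2 * 2 * 4], and
   [T q / N ^ 2] is [1 / N]. *)
rewrite (_ : _ * (2 * (1 + c^-1) * p%:R * D) = D / 4 *
  (16 * (nu4 + 1) * (1 + c^-1) * C2 * (p%:R * ((T%:R * q%:R) / N ^+ 2)))); last first.
  by move: (N) N0 => N' N'0; field; rewrite (lt0r_neq0 N'0) (lt0r_neq0 c0).
by rewrite -natrM -/N expr2 invfM mulVKf ?gt_eqF.
Qed.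

End FixedSize.

(** * The test statistic *)

Section TestStatistic.
Context {R : realType} (p T q : nat).
Variables (Sigma0 : 'M[R]_p) (V : 'M[R]_q) (Y : 'I_T -> 'M[R]_(p, q)).
Hypotheses (p0 : (0 < p)%N) (T0 : (0 < T)%N) (q0 : (0 < q)%N).
Let N : R := (T * q)%:R.
Let SV := V *m V^T.
Let W : 'M[R]_p := N^-1 *: \sum_t (invsqrtmx Sigma0 *m Y t) *m (invsqrtmx Sigma0 *m Y t)^T.

Let N0 : 0 < N. Proof. by rewrite ltr0n muln_gt0 T0 q0. Qed.
Let pR0 : (0 : R) < p%:R. Proof. by rewrite ltr0n. Qed.
Let qR0 : (0 : R) < q%:R. Proof. by rewrite ltr0n. Qed.

Lemma scaled_gram_sum_sym : W^T = W.
Proof.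
rewrite /W linearZ/= linear_sum/=; congr (_ *: _).
by apply: eq_bigr => t _; exact: gram_sym.
Qed.

Lemma lin_eig_stat_S_tilde :
  lin_eig_stat (fun x => x ^+ 2) (S_tilde Sigma0 Y) =
  N / p%:R * \tr ((W - 1%:M) *m (W - 1%:M)).
Proof.
have -> : S_tilde Sigma0 Y = Num.sqrt (N / p%:R) *: (W - 1%:M) by [].
rewrite lin_eig_stat_symmetric; last first.
  by rewrite linearZ/= linearB/= trmx1 scaled_gram_sum_sym.
rewrite -scalemxAl -scalemxAr scalerA linearZ/= -expr2 sqr_sqrtr//.
by rewrite divr_ge0.
Qed.

Variables (nu4 c C2 z : R).
Hypotheses (trV : \tr SV = q%:R) (trV2 : \tr (SV *m SV) <= q%:R * C2).

(** The eigenvalue sum is at least [N c / 4], while [mu + z sigma] is at most [p] times the constant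
    in the second premise. *)
Lemma test_stat_gt : p%:R * c / 4 <= \tr ((W - 1%:M) *m (W - 1%:M)) ->
  p%:R / N * (C2 * (2 + `|nu4 - 3| + 2 * `|z|)) < c / 4 ->
  z < `|test_stat (fun x => x ^+ 2) (mu_sq p nu4 SV)
         (Num.sqrt (sigma2_sq SV)) Sigma0 Y|.
Proof.
move=> Hc Hp.
have sSV : SV^T = SV by exact: gram_sym.
set L := avg_trace (SV *m SV).
(* From [q ^ 2 = (tr SV)^2 <= q tr (SV^2)]; this keeps the standard deviation [2 L] away from 0. *)
have L1 : 1 <= L.
  rewrite /L /avg_trace mulrC ler_pdivlMr// mul1r -(ler_pM2l qR0).
  by have := sqr_trace_le sSV; rewrite trV expr2.
have LC : L <= C2 by rewrite /L /avg_trace mulrC ler_pdivrMr// mulrC.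
have C1 : 1 <= C2 := le_trans L1 LC.
have -> : Num.sqrt (sigma2_sq SV) = 2 * L.
  rewrite /sigma2_sq -/L (_ : 4 * L ^+ 2 = (2 * L) ^+ 2); last by ring.
  by rewrite sqrtr_sqr ger0_norm// mulr_ge0// (le_trans _ L1).
have L0 : 0 < 2 * L by rewrite mulr_gt0// (lt_le_trans _ L1).
apply: (lt_le_trans _ (ler_norm _)).
rewrite /test_stat ltr_pdivlMr// lin_eig_stat_S_tilde.
have Hmu : mu_sq p nu4 SV <= p%:R * (C2 * (2 + `|nu4 - 3|)).
  have H1 : q%:R^-1 * (nu4 - 3) * \sum_j SV j j ^+ 2 <= `|nu4 - 3| * C2.
    rewrite mulrAC mulrC; set s := q%:R^-1 * _.
    have s0 : 0 <= s by rewrite mulr_ge0 ?invr_ge0// sumr_ge0// => i _; exact: sqr_ge0.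
    have sC : s <= C2.
      by rewrite (le_trans _ LC)// ler_wpM2l ?invr_ge0// sum_diag_sqr_le.
    rewrite (@le_trans _ _ (`|nu4 - 3| * s))//; first by rewrite ler_wpM2r// ler_norm.
    by rewrite ler_wpM2l.
  have p1 : (1 : R) <= p%:R by rewrite (ler_nat _ 1).
  rewrite /mu_sq -/L -natr1.
  have a0 := normr_ge0 (nu4 - 3); set a := `|nu4 - 3| in H1 a0 *.
  apply: (le_trans (lerD (ler_wpM2l _ LC) H1)); first by rewrite addr_ge0.
  (* The last summand is the slack, nonnegative because [p >= 1]. *)
  have -> : p%:R * (C2 * (2 + a)) = (p%:R + 1) * C2 + a * C2 + (p%:R - 1) * (C2 * (1 + a)) by ring.
  by rewrite lerDl mulr_ge0 ?subr_ge0// mulr_ge0 ?addr_ge0// (le_trans _ C1).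
have Hz : z * (2 * L) <= p%:R * (C2 * (2 * `|z|)).
  apply: (@le_trans _ _ (`|z| * (2 * L))); first by rewrite ler_pM2r// ler_norm.
  have -> : p%:R * (C2 * (2 * `|z|)) = (p%:R * `|z|) * (2 * C2) by ring.
  apply: ler_pM => //; first exact: ltW.
    by rewrite ler_peMl// (ler_nat _ 1).
  by rewrite ler_wpM2l.
have Hs : N * (c / 4) <= N / p%:R * \tr ((W - 1%:M) *m (W - 1%:M)).
  rewrite -mulrA ler_wpM2l ?(ltW N0)// [leRHS]mulrC ler_pdivlMr// mulrC mulrA.
  exact: Hc.
have Hn : p%:R * (C2 * (2 + `|nu4 - 3| + 2 * `|z|)) < N * (c / 4).
  by rewrite -(ltr_pM2l N0) in Hp; rewrite mulrA [N * _]mulrC divfK ?gt_eqF in Hp.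
lra.
Qed.

End TestStatistic.

(** * Lower bound for the rejection probability *)

Section RejectionProbability.
Context {R : realType} (p T q : nat) d (Om : measurableType d)
  (P : probability Om R) (X : 'I_T -> 'I_p -> 'I_q -> {RV P >-> R}).
Variables (nu4 c C2 z : R) (U : 'M[R]_p) (V : 'M[R]_q) (Sigma0 : 'M[R]_p).
Hypothesis indX : independent_RVs
  (fun k : 'I_T * 'I_p * 'I_q => X k.1.1 k.1.2 k.2).
Hypothesis EX1 : forall t i j, (\int[P]_w (X t i j w)%:E = 0)%E.
Hypothesis EX2 : forall t i j, (\int[P]_w (X t i j w ^+ 2)%:E = 1)%E.
Hypothesis EX4 : forall t i j, (\int[P]_w (X t i j w ^+ 4)%:E = nu4%:E)%E.
Hypotheses (p0 : (0 < p)%N) (T0 : (0 < T)%N) (q0 : (0 < q)%N).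
Hypotheses (trV : \tr (V *m V^T) = q%:R)
  (trV2 : \tr ((V *m V^T) *m (V *m V^T)) <= q%:R * C2).
Let K := invsqrtmx Sigma0.
Let D := K *m (U *m U^T) *m K - 1%:M.
Hypotheses (c0 : 0 < c) (cD : c <= p%:R^-1 * \tr (D *m D)).
Let Y w := samp_Y U V (fun t => \matrix_(i, j) X t i j w).
Let reject := [set w | z < `|test_stat (fun x => x ^+ 2) (mu_sq p nu4 (V *m V^T))
         (Num.sqrt (sigma2_sq (V *m V^T))) Sigma0 (Y w)|].

Let sample_covE w :
  sample_cov X (K *m U) V w =
  (T * q)%:R^-1 *: \sum_t (K *m Y w t) *m (K *m Y w t)^T.
Proof. by congr (_ *: _); apply: eq_bigr => t _; rewrite !mulmxA. Qed.

Let sub1E (W : 'M[R]_p) i j : (W - 1%:M) i j = W i j - (i == j)%:R.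
Proof. by rewrite !mxE. Qed.

Lemma measurable_reject : measurable reject.
Proof.
have mS : measurable_fun setT (fun w => test_stat (fun x => x ^+ 2)
    (mu_sq p nu4 (V *m V^T)) (Num.sqrt (sigma2_sq (V *m V^T))) Sigma0 (Y w)).
  apply: measurable_funM => //; apply: measurable_funB => //.
  under eq_fun do rewrite lin_eig_stat_S_tilde -sample_covE.
  apply: measurable_funM => //.
  apply: measurable_sum => i; under eq_fun do rewrite mxE.
  apply: measurable_sum => j; under eq_fun do rewrite !sub1E.
  by apply: measurable_funM; apply: measurable_funB => //; 
    exact: (measurable_sample_cov X T0 q0 _ trV).
have := @measurable_fun_ltr _ _ _ setT (cst z) _ (measurable_cst z)
  (measurableT_comp (@normr_measurable _ setT) mS) measurableT [set true] I.
rewrite setTI; congr measurable.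
Qed.

(** Outside the event [B] that the sample covariance is far from its mean, [frobenius_perturb] and
    [test_stat_gt] force rejection; [sample_cov_dist_tail] bounds the probability of [B]. *)
Lemma rejection_probability_ge :
  p%:R / (T * q)%:R * (C2 * (2 + `|nu4 - 3| + 2 * `|z|)) < c / 4 ->
  ((1 - 16 * (nu4 + 1) * (1 + c^-1) * C2 * (p%:R / (T * q)%:R))%:E <= P reject)%E.
Proof.
move=> Hp.
have sK : K^T = K by exact: invsqrtmx_sym.
have DE : D = (K *m U) *m (K *m U)^T - 1%:M.
  by rewrite /D trmx_mul sK !mulmxA.
have cpD : p%:R * c <= \tr (D *m D).
  by move: cD; rewrite mulrC ler_pdivlMr ?ltr0n// mulrC.
have tail := sample_cov_dist_tail indX EX1 EX2 EX4 T0 q0 trV p0 c0 (A := K *m U).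
rewrite -DE in tail.
have {}tail := tail _ cpD trV2.
set B := [set w | _] in tail.
have mB : measurable B.
  have mZ := measurable_sample_cov_dist X T0 q0 (K *m U) trV.
  have := @measurable_fun_ler _ _ _ setT (cst (\tr (D *m D) / 4)) _
    (measurable_cst _) mZ measurableT [set true] I.
  by rewrite setTI.
apply: (@le_trans _ _ (P (~` B))).
  rewrite probability_setC// EFinB leeB//.
apply: le_measure; rewrite ?inE.
- exact: measurableC.
- exact: measurable_reject.
move=> w /negP; rewrite -ltNge => Bw.
apply: (test_stat_gt p0 T0 q0 trV trV2 _ Hp).
rewrite -sample_covE.
apply: (@le_trans _ _ (\tr (D *m D) / 4)); first by rewrite ler_pM2r// invr_gt0.
apply: (frobenius_perturb (M := (K *m U) *m (K *m U)^T)) => //.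
- by rewrite sample_covE scaled_gram_sum_sym.
- exact: gram_sym.
- by rewrite DE.
Qed.

End RejectionProbability.

(** * Passage to the limit in the rejection probability *)

Theorem theorem3 (R : realType)
  (p T q : nat -> nat)
  (d : nat -> measure_display) (Omega : forall n, measurableType (d n))
  (P : forall n, probability (Omega n) R)
  (X : forall n, 'I_(T n) -> 'I_(p n) -> 'I_(q n) -> {RV (P n) >-> R})
  (U : forall n, 'M[R]_(p n)) (V : forall n, 'M[R]_(q n))
  (Sigma0 : forall n, 'M[R]_(p n))
  (F : probability (measurableTypeR R) R) (nu4 delta0 c alpha : R) :
  let SigmaU n := U n *m (U n)^T in
  let SigmaV n := V n *m (V n)^T in
  let Xmx n (w : Omega n) (t : 'I_(T n)) := \matrix_(i, j) X n t i j w in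
  let Y n (w : Omega n) := samp_Y (U n) (V n) (@Xmx n w) in
  let Tstat n (w : Omega n) :=
    test_stat (fun x => x ^+ 2) (mu_sq (p n) nu4 (SigmaV n))
      (Num.sqrt (sigma2_sq (SigmaV n))) (Sigma0 n) (@Y n w) in
  (* asymptotic regime *)
  minn (p n) (minn (T n) (q n)) @[n --> \oo] --> \oo ->
  (p n)%:R / (T n * q n)%:R @[n --> \oo] --> (0 : R) ->
  (* all entries are independent with common law F *)
  (forall n, independent_RVs
     (fun k : 'I_(T n) * 'I_(p n) * 'I_(q n) => X n k.1.1 k.1.2 k.2)) ->
  (forall n t i j B, measurable B ->
     distribution (P n) (X n t i j) B = F B) ->
  (* moments of F *)
  ('E_F[(fun x => x)])%E = 0%E ->
  ('V_F[(fun x => x)])%E = 1%E ->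
  ('E_F[(fun x => (x ^+ 4)%R)])%E = nu4%:E ->
  0 < delta0 ->
  ('E_F[(fun x => (`|x| `^ (4 + delta0))%R)] < +oo)%E ->
  (* row and column covariance matrices *)
  bounded_eigenvalues SigmaU ->
  bounded_eigenvalues (fun n => (1%:M : 'M[R]_(T n)) *t SigmaV n) ->
  esd_cvg_nondegenerate SigmaU ->
  esd_cvg_nondegenerate (fun n => (1%:M : 'M[R]_(T n)) *t SigmaV n) ->
  (forall n, (q n)%:R^-1 * \tr (SigmaV n) = 1) ->
  (* alternative hypothesis *)
  (forall n, posdefmx (Sigma0 n)) ->
  (forall n, SigmaU n <> Sigma0 n) ->
  0 < c ->
  (forall n,
     let D := invsqrtmx (Sigma0 n) *m SigmaU n *m invsqrtmx (Sigma0 n) - 1%:M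
     in c <= (p n)%:R^-1 * \tr (D *m D)) ->
  0 < alpha < 1 ->
  P n [set w | normal_quantile alpha < `|Tstat n w|] @[n --> \oo] --> 1%E.

Proof.
move=> SigmaU SigmaV Xmx Y Tstat Hmin Hratio indX lawX EF1 VF EF4 _ _ _ [C HC] _ _ trV _ _ c0 cD _.
pose z := normal_quantile alpha.
pose ratio n : R := (p n)%:R / (T n * q n)%:R.
have EX4 n t i j : (\int[P n]_w (X n t i j w ^+ 4)%:E = nu4%:E)%E.
  rewrite (ge0_integral_law (lawX n t i j) (f := fun x => x ^+ 4)).
  - by move: EF4; rewrite unlock.
  - exact: measurable_funX.
  - by move=> x; exact: exprn_even_ge0.
have EX2 n t i j : (\int[P n]_w (X n t i j w ^+ 2)%:E = 1)%E.
  rewrite (ge0_integral_law (lawX n t i j) (f := fun x => x ^+ 2)).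
  - move: VF; rewrite /variance covariance.unlock EF1/= unlock => <-.
    apply: eq_integral => x _; congr (_%:E).
    by rewrite -[RHS]/((x - 0) * (x - 0)) subr0 expr2.
  - exact: measurable_funX.
  - by move=> x; exact: exprn_even_ge0.
have EX1 n t i j : (\int[P n]_w (X n t i j w)%:E = 0)%E.
  rewrite (integral_law (lawX n t i j) (f := id)).
  - by move: EF1; rewrite unlock.
  - exact: measurable_id.
  (* Integrability of a single entry follows from its fourth moment, through a family indexed by
     [unit]. *)
  - have := @integrable_pow4 _ _ _ (P n) _ (fun _ : unit => X n t i j) nu4
      (fun _ => EX4 n t i j) tt 1 isT.
    by under eq_fun do rewrite expr1.
(* The constant of [rejection_probability_ge] with [C2 = C ^+ 2], where [C] bounds the eigenvalues
   of the tensor product. *)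
pose K := 16 * (nu4 + 1) * (1 + c^-1) * C ^+ 2.
pose B n := (1 - K * ratio n)%:E.
have near_pos : \forall n \near \oo, [&& 0 < p n, 0 < T n & 0 < q n]%N.
  have /cvgnyPge /(_ 1%N) := Hmin.
  by apply: filterS => n; rewrite !leq_min => /and3P[-> -> ->].
have near_small : \forall n \near \oo,
    ratio n * (C ^+ 2 * (2 + `|nu4 - 3| + 2 * `|z|)) < c / 4.
  set e := C ^+ 2 * _.
  have : ratio n * e @[n --> \oo] --> (0 : R).
    rewrite -[X in _ --> X](mul0r e); apply: cvgM => //; exact: cvg_cst.
  move=> /cvgr_lt; apply; by rewrite divr_gt0.
have trVq n : (0 < q n)%N -> \tr (SigmaV n) = (q n)%:R.
  move=> q0; have := trV n; move=> /(congr1 (fun x => (q n)%:R * x)).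
  by rewrite mulr1 mulVKf// pnatr_eq0 -lt0n.
have trV2 n : (0 < T n)%N -> \tr (SigmaV n *m SigmaV n) <= (q n)%:R * C ^+ 2.
  move=> T0; apply: trace_sq_le; first exact: gram_sym.
  move=> a ea; apply: (HC n).
  case: (T n) T0 => // m _.
  exact: eigenvalue_tens1.
(* The rejection probability lies eventually between [1 - K * ratio n] and 1, and [ratio n] tends to
   0. *)
apply: (@squeeze_cvge _ _ _ _ B _ (cst 1%E)).
- near=> n.
  have /and3P[p0 T0 q0] : [&& 0 < p n, 0 < T n & 0 < q n]%N by near: n.
  apply/andP; split.
    apply: (rejection_probability_ge (indX n) (EX1 n) (EX2 n) (EX4 n)
      p0 T0 q0 (trVq n q0) (trV2 n T0) c0 (cD n)).
    by near: n.
  apply: probability_le1.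
  exact: (measurable_reject (X n) nu4 z (U n) (Sigma0 n) T0 q0 (trVq n q0)).
- apply: cvg_EFin; first by near=> n.
  rewrite -[X in _ --> X]subr0 -(mulr0 K).
  apply: cvgB; first exact: cvg_cst.
  by apply: cvgM => //; exact: cvg_cst.
- exact: cvg_cst.
Unshelve. all: by end_near.
Qed.
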